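(* Let $X$ be an arbitrary set. Then: (i) $\mathcal G_X^R = \{\alpha\in\mathcal{PB}_X : \operatorname{Dom}(\alpha)=X\} = \{\alpha\in\mathcal{PB}_X : \operatorname{def}(\alpha)=0\}$; (ii) $\mathcal G_X^L = \{\alpha\in\mathcal{PB}_X : \operatorname{Codom}(\alpha)=X\} = \{\alpha\in\mathcal{PB}_X : \operatorname{codef}(\alpha)=0\}$; (iii) $\mathcal G_X = \{\alpha\in\mathcal{PB}_X : \operatorname{Dom}(\alpha)=\operatorname{Codom}(\alpha)=X\} = \{\alpha\in\mathcal{PB}_X : \operatorname{def}(\alpha)=\operatorname{codef}(\alpha)=0\}$; (iv) $\mathcal G_X^L=\mathcal G_X$ if and only if $\mathcal G_X^R=\mathcal G_X$ if and only if $X$ is finite (i.e. these three conditions are equivalent).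
   Context: Partial Brauer monoid. Let $X$ be a set and $X'=\{x':x\in X\}$ a disjoint copy of $X$. A Brauer graph is an (undirected) graph with vertex set $X\cup X'$ in which every vertex has degree at most $1$; $\mathcal{PB}_X$ is the set of all of them. Product: let $X''=\{x'':x\in X\}$ be another disjoint copy of $X$; given $\alpha,\beta\in\mathcal{PB}_X$, let $\alpha^\vee$ be $\alpha$ with each vertex $x'$ renamed $x''$, let $\beta^\wedge$ be $\beta$ with each vertex $x\in X$ renamed $x''$, and let $\Pi(\alpha,\beta)$ be the graph on $X\cup X'\cup X''$ with all edges of $\alpha^\vee$ and $\beta^\wedge$. Then $\alpha\beta$ is the graph on $X\cup X'$ with an edge $\{x,y\}$ whenever $x,y\in X\cup X'$ are distinct and lie in the same connected component of $\Pi(\alpha,\beta)$. This makes $\mathcal{PB}_X$ a monoid with identity the graph with edge set $\{\{x,x'\}:x\in X\}$. A transversal of $\alpha$ is an edge $\{x,y'\}$ with $x,y\in X$ (possibly $x=y$). $\operatorname{Dom}(\alpha)$ is the set of $x\in X$ such that $x$ belongs to a transversal of $\alpha$; $\operatorname{Codom}(\alpha)$ is the set of $x\in X$ such that $x'$ belongs to a transversal; $\operatorname{def}(\alpha)=|X\setminus\operatorname{Dom}(\alpha)|$ and $\operatorname{codef}(\alpha)=|X\setminus\operatorname{Codom}(\alpha)|$. In a monoid $M$, an element $x$ is a left unit if $ax=1$ for some $a\in M$, a right unit if $xb=1$ for some $b\in M$, and a unit if it is both. $\mathcal G_X^L$, $\mathcal G_X^R$ and $\mathcal G_X=\mathcal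 G_X^L\cap\mathcal G_X^R$ denote the sets (submonoids) of all left units, right units, and units of $\mathcal{PB}_X$, respectively. *)

(* Defs.v *)
From HB Require Import structures.
From Stdlib Require Import Relation_Operators Operators_Properties.
From mathcomp Require Import all_boot.
From mathcomp Require Import boolp classical_sets functions cardinality.

Set Implicit Arguments.
Unset Strict Implicit.
Unset Printing Implicit Defensive.

Local Open Scope classical_set_scope.
Local Open Scope card_scope.

(* The vertex set of a Brauer graph is X + X: [inl x] is x, [inr x] is x'.
   Undirected loopless graphs are symmetric irreflexive relations, so that
   [adj u] is the set of neighbours of u; as [adj] is Prop-valued, Brauer
   graphs with the same edges are equal (lemma [brauer_eq]). *)
Record partial_brauer (X : Type) := PartialBrauer {
  adj : X + X -> X + X -> Prop;
  adj_sym : forall u v, adj u v -> adj v u;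
  adj_irr : forall u, ~ adj u u;
  adj_deg1 : forall u, is_subset1 (adj u) }.

Lemma brauer_eq X (a b : partial_brauer X) :
  (forall u v, adj a u v <-> adj b u v) -> a = b.
Proof.
case: a b => [e s i d] [e' s' i' d'] /= H.
have E : e = e' by apply/funext => u; apply/funext => v; apply/propext.
case: _ / E in s' i' d' H *.
by congr PartialBrauer; apply: Prop_irrelevance.
Qed.

Section Graphs.

Definition rename V W (f : V -> W) (E : V -> V -> Prop) (p q : W) : Prop :=
  exists u v, [/\ E u v, f u = p & f v = q].

Definition union_graph V (E F : V -> V -> Prop) (p q : V) : Prop :=
  E p q \/ F p q.

(* For symmetric E: p and q are in the same connected component. *)
Definition same_component V (E : V -> V -> Prop) : V -> V -> Prop :=
  clos_refl_trans V E.

Lemma rename_sym V W (f : V -> W) E :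
  (forall u v, E u v -> E v u) ->
  forall p q, rename f E p q -> rename f E q p.
Proof. by move=> s p q [u [v [/s h <- <-]]]; exists v, u. Qed.

Lemma rename_deg1 V W (f : V -> W) E : injective f ->
  (forall u, is_subset1 (E u)) -> forall p, is_subset1 (rename f E p).
Proof.
move=> fi d p q r [u [v [h <- <-]]] [u' [v' [h' /fi e <-]]].
by rewrite e in h'; rewrite (d _ _ _ h h').
Qed.

Lemma comp_sym V (E : V -> V -> Prop) : (forall u v, E u v -> E v u) ->
  forall p q, same_component E p q -> same_component E q p.
Proof.
move=> s p q; elim=> [x y /s h|x|x y z _ h1 _ h2]; first exact: rt_step.
  exact: rt_refl.
exact: rt_trans h2 h1.
Qed.

Lemma comp_mono V W (f : V -> W) (E : V -> V -> Prop) (F : W -> W -> Prop) :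
  (forall u v, E u v -> same_component F (f u) (f v)) ->
  forall p q, same_component E p q -> same_component F (f p) (f q).
Proof.
move=> H p q; elim=> [x y /H //|x|x y z _ h1 _ h2]; first exact: rt_refl.
exact: rt_trans h1 h2.
Qed.

Lemma comp_ind V (E : V -> V -> Prop) p (P : V -> Prop) :
  P p -> (forall u v, same_component E p u -> P u -> E u v -> P v) ->
  forall q, same_component E p q -> P q.
Proof.
move=> P0 PS q /clos_rt_rtn1_iff; elim=> // u v h /clos_rt_rtn1_iff pu Pu.
exact: PS pu Pu h.
Qed.

(* A component of a union of two partial matchings is a path or a cycle, hence
   has at most two vertices that are not incident with both matchings. *)
Section TwoMatchings.
Variables (V : Type) (E : bool -> V -> V -> Prop).
Hypothesis Es : forall c u v, E c u v -> E c v u.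
Hypothesis Ed : forall c u, is_subset1 (E c u).

Let step (s t : V * bool) : Prop := E s.2 s.1 t.1 /\ t.2 = ~~ s.2.
Let reach := clos_refl_trans_n1 (V * bool) step.

Let reach1n s t : reach s t -> clos_refl_trans_1n _ step s t.
Proof. by move=> h; apply/clos_rt_rt1n_iff/clos_rtn1_rt. Qed.

Lemma step_det s t t' : step s t -> step s t' -> t = t'.
Proof.
by case: t t' => [t c] [t' c'] [/= h ->] [/= h' ->]; rewrite (Ed h h').
Qed.

Lemma reach_cmp s t t' : reach s t -> reach s t' -> reach t t' \/ reach t' t.
Proof.
move=> st; elim=> [|u v uv su IH]; first by right.
case: IH => [tu|]; first by left; apply: Relation_Operators.rtn1_trans uv tu.
move=> ut; have ut' := reach1n ut.
case: ut' uv => [uv|w t0 uw wt uv].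
  by left; apply: Relation_Operators.rtn1_trans uv _; apply: rtn1_refl.
by rewrite (step_det uv uw); right; apply: clos_rt_rtn1 (clos_rt1n_rt _ _ _ _ wt).
Qed.

Lemma reach_end s t : reach s t -> (forall u, ~ step s u) -> s = t.
Proof.
move=> /reach1n [//|u v su _ H].
by case: (H u).
Qed.

Definition end_vertex p := forall u v, E true p u -> E false p v -> False.

Lemma matching_component p q r :
  end_vertex p -> end_vertex q -> end_vertex r -> p <> q -> p <> r ->
  same_component (union_graph (E true) (E false)) p q ->
  same_component (union_graph (E true) (E false)) p r -> q = r.
Proof.
move=> ep eq er npq npr pq pr.
have [c0 Hc0] : exists c0, forall u, ~ E (~~ c0) p u.
  have [[u pu]|nu] := pselect (exists u, E true p u).
    by exists true => v pv; apply: ep pu pv.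
  by exists false => v pv; apply: nu; exists v.
have R w : same_component (union_graph (E true) (E false)) p w ->
    exists c, reach (p, c0) (w, c).
  move: w; apply: comp_ind; first by exists c0; apply: rtn1_refl.
  move=> u v _ [c pu] uv.
  have {uv} [c' uv] : exists c', E c' u v by case: uv; [exists true|exists false].
  have [e|ne] := eqVneq c' c.
    by rewrite e in uv; exists (~~ c); apply: Relation_Operators.rtn1_trans pu.
  have {ne} e : c' = ~~ c by case: c' c ne {pu uv} => [] [].
  rewrite {}e in uv.
  move: (pu); set s := (u, c) => pu'.
  have : s = (u, c) by [].
  case: pu' => [[e1 e2]|[x d] y [/= h e] px ys].
    by case: (Hc0 v); rewrite e1 e2.
  rewrite ys /= in h e; rewrite e negbK in uv.
  by exists d; rewrite (Ed uv (Es h)).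
have L w : p <> w -> end_vertex w ->
    forall c, reach (p, c0) (w, c) -> forall s, ~ step (w, c) s.
  move=> npw ew c; move te: (w, c) => t h.
  case: h te => [[e _]|[x d] t' [/= h e] _ te s]; first by rewrite e in npw.
  rewrite -te /= in h e *; rewrite {}e => -[/= h' _].
  by case: d h h' {te} => /Es h h'; [apply: ew h h'|apply: ew h' h].
have [c hq] := R _ pq; have [d hr] := R _ pr.
case: (reach_cmp hq hr) => h.
  by have [] := reach_end h (L _ npq eq _ hq).
by have [] := reach_end h (L _ npr er _ hr).
Qed.

End TwoMatchings.
End Graphs.

Section Product.
Variable X : Type.
Implicit Types a b c : partial_brauer X.

(* In the product graph, the vertex set is X + X' + X'' = (X + X) + X:
   [inl u] is u for u in X or X', and [inr x] is x''. *)
Definition low_to_mid (u : X + X) : X + X + X :=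
  match u with inl x => inl (inl x) | inr x => inr x end.

Definition up_to_mid (u : X + X) : X + X + X :=
  match u with inl x => inr x | inr x => inl (inr x) end.

Definition product_graph a b : X + X + X -> X + X + X -> Prop :=
  union_graph (rename low_to_mid (adj a)) (rename up_to_mid (adj b)).

Definition mul_adj a b (u v : X + X) : Prop :=
  u <> v /\ same_component (product_graph a b) (inl u) (inl v).

Lemma product_graph_sym a b p q : product_graph a b p q -> product_graph a b q p.
Proof.
by case=> h; [left|right]; apply: rename_sym h; apply: adj_sym.
Qed.

Lemma mul_adj_sym a b u v : mul_adj a b u v -> mul_adj a b v u.
Proof.
move=> [n h]; split; first by move=> e; apply: n.
exact: comp_sym (@product_graph_sym a b) _ _ h.
Qed.

Lemma mul_adj_irr a b u : ~ mul_adj a b u u.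
Proof. by case. Qed.

Lemma low_to_mid_inj : injective low_to_mid.
Proof. by move=> [x|x] [y|y] //= [->]. Qed.

Lemma up_to_mid_inj : injective up_to_mid.
Proof. by move=> [x|x] [y|y] //= [->]. Qed.

Lemma mul_adj_deg1 a b u : is_subset1 (mul_adj a b u).
Proof.
move=> v w [nuv uv] [nuw uw].
pose E (k : bool) := if k then rename low_to_mid (adj a)
                     else rename up_to_mid (adj b).
have Es k p q : E k p q -> E k q p.
  by case: k; apply: rename_sym; apply: adj_sym.
have Ed k p : is_subset1 (E k p).
  case: k; apply: rename_deg1; try exact: adj_deg1.
    exact: low_to_mid_inj.
  exact: up_to_mid_inj.
have Ee t : end_vertex E (inl t).
  by move=> p q [[x|x] [y [_ //= + _]]] [[x'|x'] [y' [_ //= + _]]] => <-.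
have ne t : u <> t -> inl X u <> inl X t by move=> n [].
by case: (matching_component Es Ed (Ee u) (Ee v) (Ee w) (ne _ nuv) (ne _ nuw) uv uw).
Qed.

Definition brauer_mul a b : partial_brauer X :=
  PartialBrauer (@mul_adj_sym a b) (@mul_adj_irr a b) (@mul_adj_deg1 a b).

Definition one_adj (u v : X + X) : Prop :=
  match u, v with
  | inl x, inr y | inr x, inl y => x = y
  | _, _ => False
  end.

Lemma one_adj_sym u v : one_adj u v -> one_adj v u.
Proof. by case: u v => [x|x] [y|y]. Qed.

Lemma one_adj_irr u : ~ one_adj u u.
Proof. by case: u => x []. Qed.

Lemma one_adj_deg1 u : is_subset1 (one_adj u).
Proof. by case: u => x [y|y] [z|z] //= <- <-. Qed.

Definition brauer_one : partial_brauer X :=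
  PartialBrauer one_adj_sym one_adj_irr one_adj_deg1.

Lemma adj_component a u v : same_component (adj a) u v -> u = v \/ adj a u v.
Proof.
move: v; apply: comp_ind; first by left.
move=> w v _ [->|uw] wv; first by right.
by left; apply: adj_deg1 wv; apply: adj_sym.
Qed.

Lemma brauer_mul1l : left_id brauer_one brauer_mul.
Proof.
move=> a; apply: brauer_eq => u v; split.
  move=> [nuv h].
  pose f (p : X + X + X) := match p with inl u => u | inr x => inl x end.
  have H : forall p q, product_graph brauer_one a p q ->
      same_component (adj a) (f p) (f q).
    move=> p q [] [[x|x] [[y|y] [h' <- <-]]] //=; try (by apply: rt_step);
    by move: h' => /= ->; apply: rt_refl.
  by have [] := adj_component (comp_mono H h).
move=> h; split; first by move=> e; rewrite e in h; apply: adj_irr h.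
have H w : same_component (product_graph brauer_one a) (inl w) (up_to_mid w).
  case: w => x /=; last exact: rt_refl.
  by apply: rt_step; left; exists (inl x), (inr x).
apply: rt_trans (H u) _; apply: rt_trans (comp_sym (@product_graph_sym _ _) (H v)).
by apply: rt_step; right; exists u, v.
Qed.

Lemma brauer_mul1r : right_id brauer_one brauer_mul.
Proof.
move=> a; apply: brauer_eq => u v; split.
  move=> [nuv h].
  pose f (p : X + X + X) := match p with inl u => u | inr x => inr x end.
  have H : forall p q, product_graph a brauer_one p q ->
      same_component (adj a) (f p) (f q).
    move=> p q [] [[x|x] [[y|y] [h' <- <-]]] //=; try (by apply: rt_step);
    by move: h' => /= ->; apply: rt_refl.
  by have [] := adj_component (comp_mono H h).
move=> h; split; first by move=> e; rewrite e in h; apply: adj_irr h.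
have H w : same_component (product_graph a brauer_one) (inl w) (low_to_mid w).
  case: w => x /=; first exact: rt_refl.
  by apply: rt_step; right; exists (inr x), (inl x).
apply: rt_trans (H u) _; apply: rt_trans (comp_sym (@product_graph_sym _ _) (H v)).
by apply: rt_step; left; exists u, v.
Qed.

(* Associativity: both bracketings of a product of three graphs are read off
   from one graph with four layers of vertices, (i, x) with i = 0, 1, 2, 3. *)
Let layer2 i j (u : X + X) : nat * X :=
  match u with inl x => (i, x) | inr x => (j, x) end.
Let layer3 i j k (p : X + X + X) : nat * X :=
  match p with inl u => layer2 i k u | inr x => (j, x) end.

Let layer3_inj i j k : i != j -> j != k -> i != k -> injective (layer3 i j k).
Proof.
move=> ij jk ik p q e; move: (congr1 fst e) (congr1 snd e) => {e}.
by case: p => [[x|x]|x]; case: q => [[y|y]|y] /= e ->;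
  move: ij jk ik; rewrite -?e ?eqxx // e eqxx.
Qed.

Lemma layer_product i j k a b p q :
  rename (layer3 i j k) (product_graph a b) p q <->
  union_graph (rename (layer2 i j) (adj a)) (rename (layer2 j k) (adj b)) p q.
Proof.
split.
  by move=> [p' [q' [[]]]] [u [v [h <- <-]]] <- <-; [left|right];
    exists u, v; split=> //; [case: u {h}|case: v {h}|case: u {h}|case: v {h}].
case=> [] [u [v [h <- <-]]].
  exists (low_to_mid u), (low_to_mid v); split; [|by case: u {h}|by case: v {h}].
  by left; exists u, v.
exists (up_to_mid u), (up_to_mid v); split; [|by case: u {h}|by case: v {h}].
by right; exists u, v.
Qed.

Lemma layer_component i j k a b p q : i != j -> j != k -> i != k ->
  same_component (union_graph (rename (layer2 i j) (adj a))
                              (rename (layer2 j k) (adj b)))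
    (layer3 i j k p) q ->
  exists2 q', q = layer3 i j k q' & same_component (product_graph a b) p q'.
Proof.
move=> ij jk ik; move: q; apply: comp_ind; first by exists p => //; apply: rt_refl.
move=> u v _ [u' -> pu'] /layer_product [u'' [v' [h e <-]]].
exists v' => //; apply: rt_trans pu' _; apply: rt_step.
by rewrite -(layer3_inj ij jk ik e).
Qed.

Lemma layer_contract i j k a b (F : nat * X -> nat * X -> Prop) :
  i != j -> j != k -> i != k ->
  (forall p q, F p q -> p.1 != j /\ q.1 != j) ->
  forall p q, p.1 != j -> q.1 != j ->
  same_component (union_graph
    (union_graph (rename (layer2 i j) (adj a)) (rename (layer2 j k) (adj b)))
    F) p q <->
  same_component (union_graph
    (rename (layer2 i k) (adj (brauer_mul a b))) F) p q.
Proof.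
move=> ij jk ik Fj p q pj qj; split=> h.
  pose G := union_graph (rename (layer2 i k) (adj (brauer_mul a b))) F.
  pose P w := (w.1 != j -> same_component G p w) /\
    (w.1 = j -> exists u w', [/\ same_component G p (layer2 i k u),
       w = layer3 i j k w' & same_component (product_graph a b) (inl u) w']).
  suff: P q by case=> H _; apply: H.
  move: q h {qj}; apply: comp_ind.
    by split=> [_|e]; [apply: rt_refl|rewrite e eqxx in pj].
  move=> u v _ [Pu1 Pu2] [/layer_product uv|uv]; last first.
    have [uj vj] := Fj _ _ uv; split=> [_|e]; last by rewrite e eqxx in vj.
    by apply: rt_trans (Pu1 uj) _; apply: rt_step; right.
  have [u' [v' [h eu ev]]] := uv.
  have [w [pw wu]] : exists w, same_component G p (layer2 i k w) /\
      same_component (product_graph a b) (inl w) u'.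
    case: (eqVneq u.1 j) => [e|ne].
      have [w [w' [pw e' ww']]] := Pu2 e.
      by exists w; split=> //; rewrite (layer3_inj ij jk ik (etrans eu e')).
    have pu := Pu1 ne; rewrite -{}eu in ne pu.
    case: u' ne pu {h} => [w|x] /=; last by rewrite eqxx.
    by exists w; split=> //; apply: rt_refl.
  have wv : same_component (product_graph a b) (inl w) v'.
    by apply: rt_trans wu _; apply: rt_step.
  split=> [ne|e]; last by exists w, v'.
  rewrite -ev in ne *; case: v' ne {h ev} wv => [v'|x] /=; last by rewrite eqxx.
  move=> _ wv; have [<- //|n] := pselect (w = v').
  apply: rt_trans pw _; apply: rt_step; left; exists w, v'; split=> //.
have := @comp_mono _ _ id _ _ _ _ _ h; apply=> u v [|uv]; last first.
  by apply: rt_step; right.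
move=> [u' [v' [[_ uv] <- <-]]] /=.
have := comp_mono (f := layer3 i j k) _ uv; apply=> w w' ww'.
by apply: rt_step; left; apply/layer_product; exists w, w'.
Qed.

Lemma mul_layer i j k a b u v : i != j -> j != k -> i != k ->
  adj (brauer_mul a b) u v <-> u <> v /\
  same_component (union_graph (rename (layer2 i j) (adj a))
                              (rename (layer2 j k) (adj b)))
    (layer2 i k u) (layer2 i k v).
Proof.
move=> ij jk ik; split=> [] [n h]; split=> //.
  have := comp_mono (f := layer3 i j k) _ h; apply=> w w' ww'.
  by apply: rt_step; apply/layer_product; exists w, w'.
have [w e] := layer_component ij jk ik (h : same_component _ (layer3 i j k (inl u)) _).
by rewrite (layer3_inj ij jk ik (e : layer3 i j k (inl v) = _)).
Qed.

Lemma union_graphC V (E F : V -> V -> Prop) : union_graph E F = union_graph F E.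
Proof.
by apply/funext => x; apply/funext => y; apply/propext; apply: or_comm.
Qed.

Lemma union_graphA V (E F G : V -> V -> Prop) :
  union_graph E (union_graph F G) = union_graph (union_graph E F) G.
Proof.
apply/funext => x; apply/funext => y; apply/propext.
exact: iff_sym (or_assoc _ _ _).
Qed.

Lemma brauer_mulA : associative brauer_mul.
Proof.
move=> a b c; apply: brauer_eq => u v.
have side i j (e : partial_brauer X) m : i != m -> j != m ->
    forall p q, rename (layer2 i j) (adj e) p q -> p.1 != m /\ q.1 != m.
  by move=> im jm p q [[x|x] [[y|y] [_ <- <-]]].
have end03 w m : m != 0 -> m != 3 -> (layer2 0 3 w).1 != m.
  by case: w => x /= /negbTE m0 /negbTE m3; rewrite eq_sym ?m0 ?m3.
have A01 := side 0 1 a 2 isT isT; have A23 := side 2 3 c 1 isT isT.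
have L := @layer_contract 1 2 3 b c _ isT isT isT A01 (layer2 0 3 u)
  (layer2 0 3 v) (end03 u 2 isT isT) (end03 v 2 isT isT).
have R := @layer_contract 0 1 2 a b _ isT isT isT A23 (layer2 0 3 u)
  (layer2 0 3 v) (end03 u 1 isT isT) (end03 v 1 isT isT).
rewrite -union_graphA in R; rewrite ![union_graph _ (rename _ (adj a))]union_graphC in L.
split.
  move=> /(@mul_layer 0 1 3) -/(_ isT isT isT) [n /L/R h].
  exact/(@mul_layer 0 2 3).
move=> /(@mul_layer 0 2 3) -/(_ isT isT isT) [n /R/L h].
exact/(@mul_layer 0 1 3).
Qed.

HB.instance Definition _ := gen_eqMixin (partial_brauer X).
HB.instance Definition _ := gen_choiceMixin (partial_brauer X).
HB.instance Definition _ := isMonoid.Build (partial_brauer X)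
  brauer_mulA brauer_mul1l brauer_mul1r.

Definition Dom a : set X := [set x | exists y, adj a (inl x) (inr y)].

Definition Codom a : set X := [set y | exists x, adj a (inl x) (inr y)].

(* def(a) and codef(a) may be infinite cardinals: they are compared with the
   cardinality of a set K, so that def(a) = n reads [def_eq a `I_n]. *)
Definition def_eq T a (K : set T) : Prop := ~` Dom a #= K.

Definition codef_eq T a (K : set T) : Prop := ~` Codom a #= K.

End Product.

Section OneSidedUnits.
Variable M : monoidType.

Definition left_units : set M := [set x : M | exists a, (a * x = 1)%g].

Definition right_units : set M := [set x : M | exists b, (x * b = 1)%g].

Definition units : set M := left_units `&` right_units.

End OneSidedUnits.

Arguments left_units : clear implicits.
Arguments right_units : clear implicits.
Arguments units : clear implicits.

(* Main.v *)
Require Import Defs.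
From mathcomp Require Import all_boot.
From mathcomp Require Import boolp classical_sets functions cardinality.
From Stdlib Require Import Relation_Operators.

Local Open Scope classical_set_scope.

(** Reflecting Brauer graphs in the horizontal axis (x <-> x') is an involutive
    anti-automorphism [*] of the monoid, exchanging domains with codomains and
    left units with right units; so (ii) is the mirror image of (i), and (iii)
    is the conjunction of the two.

    For (i): if every x lies on a transversal {x, y'} of a, then in the product
    graph of a and a* the path x - y'' - x' joins x to x', and a graph
    containing all the edges {x, x'} is the identity since degrees are at
    most 1; hence a a* = 1 ([mul_dual]).  Conversely, if x lies on no
    transversal of a, then its component in the product graph of a and b,
    whatever b is, stays in the upper row X: it consists of x and possibly of
    one a-neighbour of x, neither of which is incident with a b-edge.  So x is
    not joined to x' and a b <> 1 ([Dom_mul1]).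

    For (iv): by reflection both equalities say that Dom(a) = X implies
    Codom(a) = X ([left_units_eq_units], [right_units_eq_units]).  A graph with
    Dom(a) = X contains the graph of an injection X -> X whose range is
    Codom(a), and every injection f arises so, from the graph with edges
    {x, f(x)'}.  The condition thus says that every injection X -> X is onto,
    that is, that X is Dedekind-finite ([finite_setT_inj_surj]). *)

(** * Finiteness and cardinality *)

Lemma setC_card_eq_II0 {T : Type} (A : set T) : (~` A #= `I_0)%card <-> A = setT.
Proof.
rewrite II0 card_eq0; split=> [/eqP A0|->]; last by rewrite setCT.
by rewrite -[A]setCK A0 setC0.
Qed.

Lemma infinite_setT_inj (T : Type) :
  infinite_set [set: T] <-> exists g : nat -> T, injective g.
Proof.
rewrite infiniteP; split=> [/card_leP/injfunPex [g _ gi]|[g gi]].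
  exists (fun n => val (g (to_setT n))) => m n /val_inj e.
  by have /(congr1 val) := gi _ _ (mem_setT _) (mem_setT _) e.
rewrite -(card_le_eql (inj_card_eq (in2W gi))).
exact: subset_card_le (@subsetT _ _).
Qed.

(** Infinite sets are those into which the natural numbers embed.  If y is
    missed by an injection f, the orbit y, f y, f (f y), ... is such an
    embedding; conversely an embedding g of the natural numbers gives the
    injection that shifts the range of g and fixes the other points, and
    misses [g 0]. *)
Lemma finite_setT_inj_surj (T : Type) :
  finite_set [set: T] <->
  forall f : T -> T, injective f -> forall y, exists x, f x = y.
Proof.
split=> [fin f fi y|surj].
  apply: contrapT => ny; move: fin; apply/infinite_setT_inj.
  exists (fun n => iter n f y).
  elim=> [|m IH] [|n] //= e; first by case: ny; exists (iter n f y).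
    by case: ny; exists (iter m f y).
  by rewrite (IH n (fi _ _ e)).
apply: contrapT => /infinite_setT_inj [g gi].
have shift x : exists y, (exists2 n, x = g n & y = g n.+1) \/
    (y = x /\ forall n, x <> g n).
  have [[n ->]|nx] := pselect (exists n, x = g n).
    by exists (g n.+1); left; exists n.
  by exists x; right; split=> // n e; apply: nx; exists n.
have [f Hf] := choice shift.
have fi : injective f.
  move=> x y e; case: (Hf x) (Hf y) => [[m ex fx]|[fx nx]].
    case=> [[n ey fy]|[fy ny]]; first by move: e; rewrite fx fy ex ey => /gi [->].
    by case: (ny m.+1); rewrite -fx -fy.
  case=> [[n ey fy]|[fy _]]; last by rewrite -fx -fy.
  by case: (nx n.+1); rewrite -fx -fy.
have [x fx] := surj f fi (g 0).
case: (Hf x) => [[n _]|[e nx]]; first by rewrite fx => /gi.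
by case: (nx 0); rewrite -fx.
Qed.

(** * Reflection of Brauer graphs *)

Section Reflection.
Variable X : Type.
Implicit Types (a b : partial_brauer X) (u v : X + X).

Definition swap u : X + X :=
  match u with inl x => inr x | inr x => inl x end.

Lemma swapK : involutive swap.
Proof. by case. Qed.

Definition dual_adj a u v : Prop := adj a (swap u) (swap v).

Lemma dual_adj_sym a u v : dual_adj a u v -> dual_adj a v u.
Proof. exact: adj_sym. Qed.

Lemma dual_adj_irr a u : ~ dual_adj a u u.
Proof. exact: adj_irr. Qed.

Lemma dual_adj_deg1 a u : is_subset1 (dual_adj a u).
Proof.
by move=> v w h h'; apply: (can_inj swapK); apply: adj_deg1 h h'.
Qed.

Definition dual a : partial_brauer X :=
  PartialBrauer (@dual_adj_sym a) (@dual_adj_irr a) (@dual_adj_deg1 a).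

Lemma dualK : involutive dual.
Proof.
by move=> a; apply: brauer_eq => u v; rewrite /= /dual_adj /= /dual_adj !swapK.
Qed.

Lemma dual1 : dual 1%g = 1%g.
Proof. by apply: brauer_eq => -[x|x] [y|y]; split=> //= ->. Qed.

(** The reflection turns the three-row graph of (a, b) upside down; only one
    inclusion needs a proof, as the other one is its image by [dual]. *)
Lemma dual_mul a b : dual (a * b)%g = (dual b * dual a)%g.
Proof.
have sub c d u v : adj (c * d)%g u v -> adj (dual d * dual c)%g (swap u) (swap v).
  move=> [nuv h]; split; first by move=> /(can_inj swapK).
  pose f (p : X + X + X) := match p with inl w => inl (swap w) | inr x => inr x end.
  have := @comp_mono _ _ f _ (product_graph (dual d) (dual c)) _ _ _ h.
  apply=> p q [] [w [w' [ww' <- <-]]]; apply: rt_step; [right|left];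
    exists (swap w), (swap w'); split; rewrite /= /dual_adj ?swapK //;
    by [case: (w)|case: (w')].
apply: brauer_eq => u v; split; first by move/sub; rewrite !swapK.
by move/sub; rewrite !dualK.
Qed.

Lemma Dom_dual a : Dom (dual a) = Codom a.
Proof.
by apply/seteqP; split=> x [y h]; exists y; apply: adj_sym.
Qed.

Lemma Codom_dual a : Codom (dual a) = Dom a.
Proof. by rewrite -Dom_dual dualK. Qed.

(** * One-sided units *)

Lemma brauer_eq1 a : (forall x, adj a (inl x) (inr x)) -> a = 1%g.
Proof.
move=> a1; have le u v : adj (1%g : partial_brauer X) u v -> adj a u v.
  by case: u v => [x|x] [y|y] //= <- //; apply: adj_sym.
apply: brauer_eq => u v; split=> [uv|/le //].
suff -> : v = swap u by case: (u).
by apply: adj_deg1 uv _; apply: le; case: (u).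
Qed.

Lemma mul_dual a : Dom a = setT -> (a * dual a = 1)%g.
Proof.
move=> aT; apply: brauer_eq1 => x.
have [y xy] : Dom a x by rewrite aT.
split=> //; apply: (rt_trans _ _ _ (inr y)); apply: rt_step.
  by left; exists (inl x), (inr y).
by right; exists (inl y), (inr x); split=> //; apply: adj_sym.
Qed.

Lemma Dom_mul1 a b : (a * b = 1)%g -> Dom a = setT.
Proof.
move=> ab; apply/seteqP; split=> // x _; apply: contrapT => nx.
have [_ xx'] : adj (a * b)%g (inl x) (inr x) by rewrite ab.
pose P (p : X + X + X) :=
  p = inl (inl x) \/ exists2 y, p = inl (inl y) & adj a (inl x) (inl y).
suff : P (inl (inr x)) by case=> [|[]].
move: xx'; apply: comp_ind; first by left.
move=> p q _ Pp [] [u [v [uv ep <-]]]; last first.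
  (* A b-edge never ends in the upper row. *)
  by move: Pp; rewrite -ep; case: (u) => z [|[]].
have {Pp ep} [eu|xu] : u = inl x \/ adj a (inl x) u.
  case: Pp => [e|[y e xy]]; rewrite e in ep; move: u ep uv => [z|z] //= [->] _.
    by left.
  by right.
  rewrite eu in uv; case: v uv => [y|y] uv; first by right; exists y.
  by case: nx; exists y.
by left; rewrite (adj_deg1 uv (adj_sym xu)).
Qed.

Lemma right_units_Dom : right_units (partial_brauer X) = [set a | Dom a = setT].
Proof.
apply/seteqP; split=> a; first by case=> b /Dom_mul1.
by move=> /mul_dual; exists (dual a).
Qed.

Lemma right_unit_dual a :
  right_units (partial_brauer X) (dual a) <-> left_units (partial_brauer X) a.
Proof.
split=> -[b ab]; exists (dual b).
  by rewrite -(dualK a) -dual_mul ab dual1.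
by rewrite -dual_mul ab dual1.
Qed.

Lemma left_units_Codom : left_units (partial_brauer X) = [set a | Codom a = setT].
Proof.
apply/seteqP; split=> a.
  by move/right_unit_dual; rewrite right_units_Dom /= Dom_dual.
by move=> aT; apply/right_unit_dual; rewrite right_units_Dom /= Dom_dual.
Qed.

Lemma units_Dom_Codom :
  units (partial_brauer X) = [set a | Dom a = setT /\ Codom a = setT].
Proof.
by rewrite /units right_units_Dom left_units_Codom setIC.
Qed.

Lemma right_units_eq_units :
  right_units (partial_brauer X) = units (partial_brauer X) <->
  forall a, Dom a = setT -> Codom a = setT.
Proof.
rewrite right_units_Dom units_Dom_Codom; split=> [/seteqP [sub _] a /sub []//|H].
by apply/seteqP; split=> a /=; [move=> aT; split=> //; apply: H|case].
Qed.

Lemma left_units_eq_units :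
  left_units (partial_brauer X) = units (partial_brauer X) <->
  forall a, Dom a = setT -> Codom a = setT.
Proof.
rewrite left_units_Codom units_Dom_Codom; split=> [/seteqP [sub _] a aT|H].
  by have [] := sub (dual a); rewrite /= ?Codom_dual // Dom_dual.
apply/seteqP; split=> a /=; last by case.
by move=> aT; split=> //; rewrite -Codom_dual; apply: H; rewrite Dom_dual.
Qed.

(** * Injections as Brauer graphs *)

Section InjectionGraph.
Variables (f : X -> X) (fi : injective f).

Definition inj_adj u v : Prop :=
  match u, v with
  | inl x, inr y | inr y, inl x => f x = y
  | _, _ => False
  end.

Lemma inj_adj_sym u v : inj_adj u v -> inj_adj v u.
Proof. by case: u v => [x|x] [y|y]. Qed.

Lemma inj_adj_irr u : ~ inj_adj u u.
Proof. by case: u => x []. Qed.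

Lemma inj_adj_deg1 u : is_subset1 (inj_adj u).
Proof.
by case: u => x [y|y] [z|z] //=; [move=> <- <-|move=> <- /fi ->].
Qed.

Definition inj_brauer : partial_brauer X :=
  PartialBrauer inj_adj_sym inj_adj_irr inj_adj_deg1.

End InjectionGraph.

Lemma Dom_sub_Codom_inj_surj :
  (forall a, Dom a = setT -> Codom a = setT) <->
  forall f : X -> X, injective f -> forall y, exists x, f x = y.
Proof.
split=> [H f fi y|H a aT].
  suff : Codom (inj_brauer f fi) y by [].
  by rewrite H //; apply/seteqP; split=> // x _; exists (f x).
have total x : exists y, adj a (inl x) (inr y).
  by have : Dom a x by rewrite aT.
have [f Hf] := choice total.
have fi : injective f.
  move=> x y e; have := Hf y; rewrite -e => hy.
  by have [] := adj_deg1 (adj_sym (Hf x)) (adj_sym hy).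
by apply/seteqP; split=> // y _; have [x <-] := H f fi y; exists x.
Qed.

End Reflection.

Theorem lemma4p1 (X : Type) :
  let GL := left_units (partial_brauer X) in
  let GR := right_units (partial_brauer X) in
  let G := units (partial_brauer X) in
  [/\ (* (i) *)
      GR = [set a : partial_brauer X | Dom a = setT] /\
      GR = [set a : partial_brauer X | def_eq a `I_0],
      (* (ii) *)
      GL = [set a : partial_brauer X | Codom a = setT] /\
      GL = [set a : partial_brauer X | codef_eq a `I_0],
      (* (iii) *)
      G = [set a : partial_brauer X | Dom a = setT /\ Codom a = setT] /\
      G = [set a : partial_brauer X | def_eq a `I_0 /\ codef_eq a `I_0]
    & (* (iv) *)
      (GL = G <-> GR = G) /\ (GR = G <-> finite_set [set: X])].
Proof.
move=> GL GR G.
have defE a : def_eq a `I_0 = (Dom a = setT :> set X).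
  by apply/propext; apply: setC_card_eq_II0.
have codefE a : codef_eq a `I_0 = (Codom a = setT :> set X).
  by apply/propext; apply: setC_card_eq_II0.
split.
- rewrite /GR right_units_Dom; split=> //.
  by apply: eq_set => a; rewrite defE.
- rewrite /GL left_units_Codom; split=> //.
  by apply: eq_set => a; rewrite codefE.
- rewrite /G units_Dom_Codom; split=> //.
  by apply: eq_set => a; rewrite defE codefE.
- rewrite /GL /GR /G; split.
    exact: iff_trans (left_units_eq_units X) (iff_sym (right_units_eq_units X)).
  apply: iff_trans (right_units_eq_units X) _.
  exact: iff_trans (Dom_sub_Codom_inj_surj X) (iff_sym (finite_setT_inj_surj X)).
Qed.
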